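(* Let $n>3$. Hyperspheres are the only separable hypersurfaces in $\mathbb{R}^n$ having nonzero constant sectional curvature. That is, if $M^{n-1}\subset\mathbb{R}^n$ is a separable hypersurface for which there is a constant $c\neq0$ such that $K(\Pi)=c$ for every $p\in M^{n-1}$ and every $2$-dimensional plane $\Pi\subset T_pM^{n-1}$, then $M^{n-1}$ is (an open part of) a hypersphere.
   Context: $\mathbb{R}^n$ carries its standard Euclidean metric and Cartesian coordinates $(x_1,\dots,x_n)$. A hypersurface $M^{n-1}$ of $\mathbb{R}^n$ ($n\ge 3$) is separable if it can be expressed as $M^{n-1}=\{(x_1,\dots,x_n): x_k\in I_k,\ \sum_{k=1}^n f_k(x_k)=0\}$, where $f_1,\dots,f_n$ are smooth real-valued functions of one variable defined on intervals $I_1,\dots,I_n\subset\mathbb{R}$ with $\sum_{k=1}^n f_k'(x_k)^2\neq 0$ at every point. $K(\Pi)$ denotes the sectional curvature of the metric induced on $M^{n-1}$ by $\mathbb{R}^n$. A hypersphere is a set $\{x\in\mathbb{R}^n: |x-a|=r\}$ with $a\in\mathbb{R}^n$, $r>0$. The statement is local: each point of $M^{n-1}$ has a neighbourhood in $M^{n-1}$ that is an open part of a hypersphere. *)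

(* Defs.v *)
From HB Require Import structures.
From mathcomp Require Import all_boot all_order all_algebra.
From mathcomp Require Import all_classical all_reals all_analysis.
Set Implicit Arguments.
Unset Strict Implicit.
Unset Printing Implicit Defensive.
Import Order.TTheory GRing.Theory Num.Theory.
Import numFieldNormedType.Exports.
Local Open Scope classical_set_scope.
Local Open Scope ring_scope.

Section calculus.
Context {R : realType}.

Definition partial m (W : normedModType R) (i : 'I_m) (f : 'rV[R]_m -> W) :
  'rV[R]_m -> W := fun u => 'D_(delta_mx 0 i) f u.

Definition iter_partial m (W : normedModType R) (s : seq 'I_m)
  (f : 'rV[R]_m -> W) : 'rV[R]_m -> W := foldr (@partial m W) f s.

(* C^oo: all iterated partial derivatives exist and are continuous. As U is
   open in all uses, the values of f outside U are irrelevant. *)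
Definition smooth_on m (W : normedModType R) (U : set 'rV[R]_m)
  (f : 'rV[R]_m -> W) : Prop :=
  forall (s : seq 'I_m) (u : 'rV[R]_m), U u ->
    {for u, continuous (iter_partial s f)} /\
    forall i : 'I_m, derivable (iter_partial s f) u (delta_mx 0 i).

Definition smooth1_on (I : set R) (f : R -> R) : Prop :=
  forall (k : nat) (x : R), I x -> derivable (derive1n k f) x 1.

Definition dotv n (v w : 'rV[R]_n) : R := \sum_(k < n) v 0 k * w 0 k.

(* The norm of 'rV[R]_n in the library is the sup norm. *)
Definition euclidean_norm n (v : 'rV[R]_n) : R := Num.sqrt (dotv v v).

Definition hypersphere n (a : 'rV[R]_n) (r : R) : set 'rV[R]_n :=
  [set x | euclidean_norm (x - a) = r].

Definition open_in n (A B : set 'rV[R]_n) : Prop :=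
  exists O : set 'rV[R]_n, open O /\ B = A `&` O.

End calculus.

(* A Riemannian metric in local coordinates is a matrix-valued function g. *)
Section riemannian.
Context {R : realType} {m : nat}.
Variable g : 'rV[R]_m -> 'M[R]_m.

(* christoffel i j l u is Gamma^l_ij of the Levi-Civita connection of g. *)
Definition christoffel (i j l : 'I_m) (u : 'rV[R]_m) : R :=
  2^-1 * \sum_(q < m) invmx (g u) l q *
    (partial i (fun w => g w j q) u + partial j (fun w => g w i q) u
     - partial q (fun w => g w i j) u).

(* R(d_i, d_j) d_k = \sum_l (riemann i j k l) d_l, with the convention
   R(X, Y) Z = D_X D_Y Z - D_Y D_X Z - D_[X, Y] Z. *)
Definition riemann (i j k l : 'I_m) (u : 'rV[R]_m) : R :=
  partial i (christoffel j k l) u - partial j (christoffel i k l) u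
  + \sum_(q < m) (christoffel j k q u * christoffel i q l u
                  - christoffel i k q u * christoffel j q l u).

Definition inner (u X Y : 'rV[R]_m) : R :=
  \sum_(i < m) \sum_(j < m) g u i j * X 0 i * Y 0 j.

Definition curvature_operator (u X Y Z : 'rV[R]_m) : 'rV[R]_m :=
  \row_(l < m) \sum_(i < m) \sum_(j < m) \sum_(k < m)
     X 0 i * Y 0 j * Z 0 k * riemann i j k l u.

(* Sectional curvature of the plane spanned by linearly independent X, Y. *)
Definition sec (u X Y : 'rV[R]_m) : R :=
  inner u (curvature_operator u X Y Y) X /
  (inner u X X * inner u Y Y - inner u X Y ^+ 2).

End riemannian.

Section hypersurfaces.
Context {R : realType} {n : nat}.
Implicit Types (M : set 'rV[R]_n) (U : set 'rV[R]_n.-1)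
  (phi : 'rV[R]_n.-1 -> 'rV[R]_n) (u X Y : 'rV[R]_n.-1) (p : 'rV[R]_n).

Definition chart_differential phi u X : 'rV[R]_n :=
  \sum_(i < n.-1) X 0 i *: partial i phi u.

(* phi is a smooth immersion of the open set U and a homeomorphism of U onto
   an open subset of M; openness of phi as a map into M is what makes the
   inverse continuous. *)
Definition local_parametrization M U phi : Prop :=
  [/\ open U, smooth_on U phi,
      forall u, U u -> forall X, chart_differential phi u X = 0 -> X = 0,
      set_inj U phi &
      forall U', open U' -> U' `<=` U -> open_in M (phi @` U')].

Definition tangent_vector M p (v : 'rV[R]_n) : Prop :=
  exists U phi u X, [/\ local_parametrization M U phi, U u, phi u = p
                      & chart_differential phi u X = v].

Definition induced_metric phi u : 'M[R]_n.-1 :=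
  \matrix_(i, j) dotv (partial i phi u) (partial j phi u).

(* K(Pi) = c for a tangent plane Pi at p. The value computed does not depend
   on the parametrization around p nor on the basis of Pi. *)
Definition sectional_curvature_eq M p (Pi : {vspace 'rV[R]_n}) (c : R) : Prop :=
  forall U phi u X Y, local_parametrization M U phi -> U u -> phi u = p ->
    <<[:: chart_differential phi u X; chart_differential phi u Y]>>%VS = Pi ->
    sec (induced_metric phi) u X Y = c.

Definition constant_sectional_curvature M (c : R) : Prop :=
  forall p (Pi : {vspace 'rV[R]_n}), M p -> \dim Pi = 2%N ->
    (forall v, v \in Pi -> tangent_vector M p v) ->
    sectional_curvature_eq M p Pi c.

Definition separable_hypersurface M : Prop :=
  exists (f : 'I_n -> R -> R) (I : 'I_n -> set R),
    [/\ forall k, open (I k) /\ is_interval (I k),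
        forall k, smooth1_on (I k) (f k),
        M = [set x | (forall k, I k (x 0 k)) /\ \sum_(k < n) f k (x 0 k) = 0] &
        forall x, M x -> \sum_(k < n) derive1 (f k) (x 0 k) ^+ 2 != 0].

Definition locally_open_part_of_hypersphere M : Prop :=
  forall p, M p -> exists (V : set 'rV[R]_n) (a : 'rV[R]_n) (r : R),
    [/\ 0 < r, V p, open_in M V & open_in (hypersphere a r) V].

End hypersurfaces.

(* Main.v *)
Require Import Defs.
From HB Require Import structures.
From mathcomp Require Import all_boot all_order all_algebra.
From mathcomp Require Import all_classical all_reals all_analysis.
From mathcomp Require Import ring.
Import Order.TTheory GRing.Theory Num.Theory.
Import numFieldNormedType.Exports.
Local Open Scope classical_set_scope.
Local Open Scope ring_scope.

(** Near a point with [f_l' <> 0] the hypersurface is a graph [x_l = h(u)] over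
    the other coordinates [u], with Hessian
    [h_jk = - (delta_jk f_j'' / f_l' + f_j' f_k' f_l'' / f_l'^3)]. The Gauss
    equation for the coordinate directions [e_i] and [e_j + e_k] gives, with
    [W = 1 + |grad h|^2],
    - [f_i'' f_l'' = c W f_l'^2] if [f_j', f_k' <> 0] for distinct [i, j, k];
    - [f_i'' f_j'' + (f_l'' / f_l'^2) (f_i'' f_j'^2 + f_j'' f_i'^2)
       = c W (f_l'^2 + f_i'^2 + f_j'^2)].

    By the first relation, which needs three directions other than [l], i.e.
    [n > 3], all [f_i''] agree wherever no [f_k'] vanishes, and then they equal
    [f_l''] by the second. Since [c <> 0], the second relation also prevents
    [f_i'] from vanishing on an interval, so that such points are dense and
    [f_i''(u_i) = f_l''(h(u))] everywhere. Varying the coordinates separately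
    shows that this common value is a constant [A <> 0]; integrating twice, the
    graph lies on a sphere. *)

Set Implicit Arguments.
Unset Strict Implicit.
Unset Printing Implicit Defensive.

(** * Gradients *)

Section gradient.
Context {R : realType} {m : nat}.
Implicit Types (E F : 'rV[R]_m -> R) (u v : 'rV[R]_m) (G H : 'I_m -> R).

(** Total differentiability is recorded, not just the existence of partial derivatives, so that
    continuity and the chain rule come with it. *)
Definition has_gradient E u G : Prop :=
  is_diff u E (fun v => \sum_i v 0 i * G i).

Lemma is_diff_gradient E u df G : is_diff u E df ->
  (forall v, df v = \sum_i v 0 i * G i) -> has_gradient E u G.
Proof. by rewrite /has_gradient => dE /funext <-. Qed.

Lemma has_gradient_eq E u G H :
  has_gradient E u G -> (forall i, G i = H i) -> has_gradient E u H.
Proof. by move=> dE /funext <-. Qed.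

Lemma has_gradient_derive E u G v :
  has_gradient E u G -> is_derive u v E (\sum_i v 0 i * G i).
Proof.
move=> [dE dEE]; apply: DeriveDef; first exact: diff_derivable.
by rewrite deriveE// dEE.
Qed.

Lemma sum_delta (A : 'I_m -> R) i : \sum_j (i == j)%:R * A j = A i.
Proof.
rewrite (bigD1 i)//= eqxx mul1r big1 ?addr0// => j ji.
by rewrite eq_sym (negPf ji) mul0r.
Qed.

Lemma has_gradient_partial E u G i : has_gradient E u G ->
  is_derive u (delta_mx 0 i) E (G i).
Proof.
move=> /(has_gradient_derive (delta_mx 0 i)) dE.
apply: is_derive_eq.
rewrite -(sum_delta G i); apply: eq_bigr => j _.
by rewrite mxE eqxx eq_sym.
Qed.

Lemma has_gradient_partialE E u G i : has_gradient E u G -> partial i E u = G i.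
Proof. by move=> /(has_gradient_partial i)[]. Qed.

Lemma has_gradient_continuous E u G : has_gradient E u G -> {for u, continuous E}.
Proof. by move=> [dE _]; exact: differentiable_continuous. Qed.

Lemma has_gradient_cst (a : R) u : has_gradient (fun=> a) u (fun=> 0).
Proof.
apply: is_diff_gradient (is_diff_cst a u) _ => v.
by rewrite big1// => i _; rewrite mulr0.
Qed.

Lemma has_gradient_coord u k :
  has_gradient (fun w => w 0 k) u (fun i => (k == i)%:R).
Proof.
have lin : linear (fun w : 'rV[R]_m => w 0 k) by move=> a v w; rewrite !mxE.
pose cM := GRing.isLinear.Build _ _ _ _ (fun w : 'rV[R]_m => w 0 k) lin.
pose c : {linear 'rV[R]_m -> R} := HB.pack (fun w : 'rV[R]_m => w 0 k) cM.
have -> : (fun w : 'rV[R]_m => w 0 k) = c by [].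
constructor.
  by apply: linear_differentiable => /= x; exact: coord_continuous.
rewrite diff_lin; last by move=> /= x; exact: coord_continuous.
apply/funext => v /=; under eq_bigr do rewrite mulrC.
by rewrite sum_delta.
Qed.

Lemma has_gradientD E F u G H : has_gradient E u G -> has_gradient F u H ->
  has_gradient (fun w => E w + F w) u (fun i => G i + H i).
Proof.
move=> dE dF; apply: is_diff_gradient (is_diffD dE dF) _ => v.
by rewrite fctE -big_split/=; apply: eq_bigr => i _; ring.
Qed.

Lemma has_gradientM E F u G H : has_gradient E u G -> has_gradient F u H ->
  has_gradient (fun w => E w * F w) u (fun i => G i * F u + E u * H i).
Proof.
move=> dE dF; apply: is_diff_gradient (is_diffM dE dF) _ => v.
rewrite !fctE /GRing.scale/= !mulr_sumr -big_split/=.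
by apply: eq_bigr => i _; ring.
Qed.

Lemma has_gradientZ a E u G : has_gradient E u G ->
  has_gradient (fun w => a * E w) u (fun i => a * G i).
Proof.
move=> dE; apply: has_gradient_eq (has_gradientM (has_gradient_cst a u) dE) _.
by move=> i; rewrite mul0r add0r.
Qed.

Lemma has_gradient_sum n (E : 'I_n -> 'rV[R]_m -> R) u (G : 'I_n -> 'I_m -> R) :
  (forall k, has_gradient (E k) u (G k)) ->
  has_gradient (fun w => \sum_k E k w) u (fun i => \sum_k G k i).
Proof.
elim: n E G => [|n IH] E G dE.
  have -> : (fun w => \sum_k E k w) = fun=> 0 by apply/funext => w; rewrite big_ord0.
  by apply: has_gradient_eq (has_gradient_cst 0 u) _ => i; rewrite big_ord0.
have -> : (fun w => \sum_k E k w) =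
    fun w => E ord0 w + \sum_(k < n) E (lift ord0 k) w.
  by apply/funext => w; rewrite big_ord_recl.
apply: has_gradient_eq (has_gradientD (dE ord0) (IH _ _ (fun k => dE _))) _.
by move=> i; rewrite big_ord_recl.
Qed.

Lemma has_gradient_comp (a : R -> R) E u G d : has_gradient E u G ->
  is_derive (E u) 1 a d -> has_gradient (fun w => a (E w)) u (fun i => d * G i).
Proof.
move=> dE [da dad].
have da' : is_diff (E u) a (fun x => x * d).
  constructor; first exact/derivable1_diffP.
  by rewrite deriv1E// derive1E dad.
apply: is_diff_gradient (is_diff_comp dE da') _ => v /=.
by rewrite mulr_suml; apply: eq_bigr => i _; ring.
Qed.

Lemma has_gradientV E u G : E u != 0 -> has_gradient E u G ->
  has_gradient (fun w => (E w)^-1) u (fun i => - (E u)^-2 * G i).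
Proof.
move=> E0 dE; apply: (has_gradient_comp (a := GRing.inv)) => //.
have := is_deriveV (t := 1) E0 (is_derive_id (E u : R) 1).
by move=> /is_derive_eq; apply; exact: mulr1.
Qed.

(** Mean value theorem along the segment from [u0] to [u], which stays in the ball by convexity. *)
Lemma zero_gradient_ball E (u0 u : 'rV[R]_m) (e : R) :
  ball u0 e u ->
  (forall w, ball u0 e w -> has_gradient E w (fun=> 0)) -> E u = E u0.
Proof.
move=> u0u dE; pose gam (t : R) := u0 + t *: (u - u0).
have gamB (t : R) : 0 <= t -> t <= 1 -> ball u0 e (gam t).
  move=> t0 t1; move: u0u; rewrite -!ball_normE /ball_/= /gam => u0u.
  rewrite opprD addrA subrr add0r normrN normrZ ger0_norm//.
  by rewrite (le_lt_trans _ u0u)// distrC ler_piMl.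
have dgam (t : R) : 0 <= t -> t <= 1 -> is_derive t 1 (E \o gam) 0.
  move=> t0 t1.
  have dg : is_diff t gam (fun s => s *: (u - u0)).
    have -> : gam = cst u0 + ( *:%R ^~ (u - u0)) by apply/funext.
    rewrite -[X in is_diff _ _ X]add0r.
    exact: (is_diffD (is_diff_cst u0 t) (is_diff_scalel t (u - u0))).
  have [dEg dEgE] := is_diff_comp dg (dE _ (gamB t t0 t1)).
  apply: DeriveDef; first exact/derivable1_diffP.
  rewrite deriveE// dEgE /= big1// => i _; exact: mulr0.
have := @MVT R (E \o gam) (fun=> 0) 0 1 ltr01.
case.
- by move=> x /[!in_itv]/= /andP[x0 x1]; apply: dgam; exact: ltW.
- apply: derivable_within_continuous => x /[!in_itv]/= /andP[x0 x1].
  by have [] := dgam x x0 x1.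
move=> c _; rewrite mul0r /gam /= scale1r scale0r addr0 [u0 + _]addrC subrK.
by move=> /eqP; rewrite subr_eq0 => /eqP.
Qed.

End gradient.

(** * Curvature of a graph *)

Section graph_curvature.
Context {R : realType} {m : nat}.
Variables (U : set 'rV[R]_m) (g : 'rV[R]_m -> 'M[R]_m).
Variables (h1 : 'I_m -> 'rV[R]_m -> R) (h2 : 'I_m -> 'I_m -> 'rV[R]_m -> R)
  (h3 : 'I_m -> 'I_m -> 'I_m -> 'rV[R]_m -> R).
(* g is the metric of the graph of a function whose partial derivatives of
   order 1, 2 and 3 are h1, h2 and h3. *)
Hypothesis openU : open U.
Hypothesis gE : forall u, U u -> forall i j, g u i j = (i == j)%:R + h1 i u * h1 j u.
Hypothesis h1_grad : forall u, U u -> forall i,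
  has_gradient (h1 i) u (fun j => h2 j i u).
Hypothesis h2_grad : forall u, U u -> forall i j,
  has_gradient (h2 i j) u (fun k => h3 k i j u).
Hypothesis h2_sym : forall u, U u -> forall i j, h2 i j u = h2 j i u.
Hypothesis h3_sym : forall u, U u -> forall i j k, h3 i j k u = h3 j i k u.

(** On [U], [W] is the determinant of [g], the square of the area density, and [S i] is half of its
    [i]-th partial derivative. *)
Let W u := 1 + \sum_q h1 q u ^+ 2.
Let S i u := \sum_q h1 q u * h2 i q u.

Lemma area_density_gt0 u : 0 < W u.
Proof. by apply: ltr_wpDr => //; apply: sumr_ge0 => i _; exact: sqr_ge0. Qed.

Lemma area_density_neq0 u : W u != 0.
Proof. by rewrite gt_eqF// area_density_gt0. Qed.

(** A derivative depends only on the germ, so formulas known merely on the open set [U] can be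
    differentiated there. *)
Lemma partial_near (E F : 'rV[R]_m -> R) u G i : U u ->
  (forall w, U w -> E w = F w) -> has_gradient F u G -> partial i E u = G i.
Proof.
move=> Uu EF /has_gradient_partialE <-; apply: near_eq_derive.
by near=> w; apply: EF; near: w; exact: open_nbhs_nbhs.
Unshelve. all: by end_near. Qed.

(** Sherman-Morrison formula for the identity plus a matrix of rank one. *)
Lemma graph_metric_inv u : U u -> forall l q,
  invmx (g u) l q = (l == q)%:R - h1 l u * h1 q u / W u.
Proof.
move=> Uu; pose B := \matrix_(l, q) ((l == q)%:R - h1 l u * h1 q u / W u).
suff gB : g u *m B = 1%:M.
  have [ug _] := mulmx1_unit gB.
  have -> : invmx (g u) = B by rewrite -[RHS](mulKmx ug) gB mulmx1.
  by move=> l q; rewrite mxE.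
apply/matrixP => i j; rewrite !mxE.
under eq_bigr => k _ do rewrite gE// mxE mulrDl.
rewrite big_split/= sum_delta.
under eq_bigr => k _.
  rewrite (_ : _ * _ = h1 i u * ((j == k)%:R * h1 k u)
    - h1 i u * h1 j u / W u * h1 k u ^+ 2); last by rewrite eq_sym; ring.
over.
rewrite big_split/= -mulr_sumr sum_delta sumrN -mulr_sumr.
rewrite (_ : \sum_k _ = W u - 1); last by rewrite /W addrC addKr.
by field; exact: area_density_neq0.
Qed.

Lemma partial_graph_metric u : U u -> forall q i j,
  partial q (fun w => g w i j) u = h2 q i u * h1 j u + h1 i u * h2 q j u.
Proof.
move=> Uu q i j.
have dgg := has_gradientD (has_gradient_cst (i == j)%:R u)
  (has_gradientM (h1_grad Uu i) (h1_grad Uu j)).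
by rewrite (partial_near _ Uu (fun w Uw => gE Uw i j) dgg) add0r.
Qed.

(** The symmetry of [h2] reduces the bracket of metric derivatives to [2 * h2 i j u * h1 q u], and
    the inverse metric sends the gradient [h1] to [h1 / W]. *)
Lemma graph_christoffel u : U u -> forall i j l,
  christoffel g i j l u = h1 l u * h2 i j u / W u.
Proof.
move=> Uu i j l; rewrite /christoffel.
under eq_bigr => q _.
  rewrite graph_metric_inv// !partial_graph_metric// (h2_sym Uu j i).
  rewrite (h2_sym Uu q i) (h2_sym Uu q j).
  rewrite (_ : (_ - _) * (_ - _) = (l == q)%:R * (2 * h2 i j u * h1 q u)
    - 2 * h2 i j u * h1 l u / W u * h1 q u ^+ 2); last by ring.
over.
rewrite big_split/= sum_delta sumrN -mulr_sumr.
rewrite (_ : \sum_k _ = W u - 1); last by rewrite /W addrC addKr.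
by field; exact: area_density_neq0.
Qed.

Lemma area_density_grad u : U u -> has_gradient W u (fun i => 2 * S i u).
Proof.
move=> Uu; apply: has_gradient_eq.
  apply: (has_gradientD (has_gradient_cst 1 u)).
  exact: (has_gradient_sum (fun q => has_gradientM (h1_grad Uu q) (h1_grad Uu q))).
move=> i /=; rewrite add0r /S mulr_sumr; apply: eq_bigr => q _; ring.
Qed.

Lemma graph_partial_christoffel u : U u -> forall i j k l,
  partial i (christoffel g j k l) u =
  (h2 i l u * h2 j k u + h1 l u * h3 i j k u) / W u
  - h1 l u * h2 j k u * (2 * S i u) / W u ^+ 2.
Proof.
move=> Uu i j k l.
have dG := has_gradientM (has_gradientM (h1_grad Uu l) (h2_grad Uu j k))
  (has_gradientV (area_density_neq0 u) (area_density_grad Uu)).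
rewrite (partial_near _ Uu (fun w Uw => graph_christoffel Uw j k l) dG).
by field; exact: area_density_neq0.
Qed.

(** The third derivatives cancel by [h3_sym], and the products of Christoffel symbols cancel half of
    the terms that come from differentiating [1 / W]. *)
Lemma graph_riemann u : U u -> forall i j k l,
  riemann g i j k l u =
  (h2 i l u * h2 j k u - h2 j l u * h2 i k u) / W u
  - h1 l u / W u ^+ 2 * (h2 j k u * S i u - h2 i k u * S j u).
Proof.
move=> Uu i j k l; rewrite /riemann !graph_partial_christoffel//.
under eq_bigr => q _.
  rewrite !graph_christoffel//.
  rewrite (_ : _ - _ = h1 l u * h2 j k u / W u ^+ 2 * (h1 q u * h2 i q u)
    - h1 l u * h2 i k u / W u ^+ 2 * (h1 q u * h2 j q u)); last first.
    by field; exact: area_density_neq0.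
over.
rewrite big_split/= sumrN -!mulr_sumr -/(S i u) -/(S j u) (h3_sym Uu i j).
by field; exact: area_density_neq0.
Qed.

(** The Hessian form, which is the second fundamental form up to sign and a factor [sqrt W]. Writing
    it with [inner] makes the bilinearity lemmas of [inner] available. *)
Definition second_form u (X Y : 'rV[R]_m) :=
  inner (fun w => \matrix_(i, j) h2 i j w) u X Y.

(** The Gauss equation in coordinates: lowering the index makes all terms containing [S] cancel. *)
Lemma graph_riemann_lowered u : U u -> forall i j k s,
  \sum_l g u l s * riemann g i j k l u =
  (h2 i s u * h2 j k u - h2 j s u * h2 i k u) / W u.
Proof.
move=> Uu i j k s.
under eq_bigr => l _.
  rewrite gE// graph_riemann//.
  rewrite (_ : (_ + _) * (_ - _) = (s == l)%:R * ((h2 i l u * h2 j k u - h2 j l u * h2 i k u) / W u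
      - h1 l u / W u ^+ 2 * (h2 j k u * S i u - h2 i k u * S j u))
    + h1 s u * h2 j k u / W u * (h1 l u * h2 i l u)
    - h1 s u * h2 i k u / W u * (h1 l u * h2 j l u)
    - h1 s u / W u ^+ 2 * (h2 j k u * S i u - h2 i k u * S j u) * h1 l u ^+ 2);
    last by rewrite eq_sym; field; exact: area_density_neq0.
over.
rewrite !big_split/= !sumrN -!mulr_sumr sum_delta -/(S i u) -/(S j u).
rewrite (_ : \sum_k _ = W u - 1); last by rewrite /W addrC addKr.
by field; exact: area_density_neq0.
Qed.

Lemma graph_inner_curvature u X Y : U u ->
  inner g u (curvature_operator g u X Y Y) X =
  (second_form u X X * second_form u Y Y - second_form u X Y ^+ 2) / W u.
Proof.
move=> Uu.
have -> : inner g u (curvature_operator g u X Y Y) X =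
  \sum_s \sum_i \sum_j \sum_k X 0 s * X 0 i * Y 0 j * Y 0 k *
    \sum_l g u l s * riemann g i j k l u.
  rewrite /inner exchange_big/=; apply: eq_bigr => s _.
  under eq_bigr => l _.
    rewrite mxE mulr_sumr mulr_suml.
    under eq_bigr => i _.
      rewrite mulr_sumr mulr_suml.
      under eq_bigr => j _ do rewrite mulr_sumr mulr_suml.
    over.
  over.
  rewrite exchange_big; apply: eq_bigr => i _.
  rewrite exchange_big; apply: eq_bigr => j _.
  rewrite exchange_big; apply: eq_bigr => k _.
  by rewrite mulr_sumr; apply: eq_bigr => l _; ring.
have sum_mul (a b : 'I_m -> 'I_m -> R) :
    (\sum_s \sum_i a s i) * (\sum_j \sum_k b j k)
    = \sum_s \sum_i \sum_j \sum_k a s i * b j k.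
  rewrite mulr_suml; apply: eq_bigr => s _.
  rewrite mulr_suml; apply: eq_bigr => i _.
  by rewrite mulr_sumr; apply: eq_bigr => j _; rewrite mulr_sumr.
have second_formE (A B : 'rV[R]_m) :
    second_form u A B = \sum_i \sum_j h2 i j u * A 0 i * B 0 j.
  by apply: eq_bigr => i _; apply: eq_bigr => j _; rewrite mxE.
rewrite expr2 !second_formE !sum_mul mulrBl !mulr_suml -sumrB; apply: eq_bigr => s _.
rewrite [X in _ = _ - X]mulr_suml [X in _ = X - _]mulr_suml.
(* The squared term pairs the indices as [(s, j)] and [(i, k)], the other product as [(s, i)] and
   [(j, k)]; exchanging two sums aligns them termwise. *)
rewrite [X in _ = _ - X](eq_bigr (fun j => \sum_i \sum_k
    h2 s j u * X 0 s * Y 0 j * (h2 i k u * X 0 i * Y 0 k) / W u)); last first.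
  by move=> j _; rewrite mulr_suml; apply: eq_bigr => i _; rewrite mulr_suml.
rewrite [X in _ = _ - X]exchange_big/= -sumrB; apply: eq_bigr => i _.
rewrite mulr_suml -sumrB; apply: eq_bigr => j _.
rewrite mulr_suml -sumrB; apply: eq_bigr => k _.
rewrite graph_riemann_lowered// (h2_sym Uu i s) (h2_sym Uu j s).
by field; exact: area_density_neq0.
Qed.

Lemma graph_gauss_equation u X Y (c : R) : U u -> c != 0 -> sec g u X Y = c ->
  second_form u X X * second_form u Y Y - second_form u X Y ^+ 2 =
  c * W u * (inner g u X X * inner g u Y Y - inner g u X Y ^+ 2).
Proof.
move=> Uu c0; rewrite /sec graph_inner_curvature//.
(* For a vanishing Gram determinant the quotient [sec] is 0 by the convention on inverses, which
   contradicts [c != 0]. *)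
set D := _ - inner g u X Y ^+ 2; have [->|D0 <-] := eqVneq D 0.
  by rewrite invr0 mulr0 => /esym/eqP; rewrite (negPf c0).
by field; rewrite D0 area_density_neq0.
Qed.

End graph_curvature.

(** * Bilinearity of [inner] *)

Section inner_theory.
Context {R : realType} {m : nat}.
Variables (g : 'rV[R]_m -> 'M[R]_m) (u : 'rV[R]_m).
Implicit Types X Y Z : 'rV[R]_m.

Lemma innerDl X Y Z : inner g u (X + Y) Z = inner g u X Z + inner g u Y Z.
Proof.
rewrite /inner -big_split/=; apply: eq_bigr => i _.
by rewrite -big_split/=; apply: eq_bigr => j _; rewrite mxE; ring.
Qed.

Lemma innerDr X Y Z : inner g u X (Y + Z) = inner g u X Y + inner g u X Z.
Proof.
rewrite /inner -big_split/=; apply: eq_bigr => i _.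
by rewrite -big_split/=; apply: eq_bigr => j _; rewrite mxE; ring.
Qed.

Lemma inner_delta i j : inner g u (delta_mx 0 i) (delta_mx 0 j) = g u i j.
Proof.
rewrite /inner -(sum_delta (fun i => g u i j) i); apply: eq_bigr => k _.
rewrite -(sum_delta (fun j => g u k j) j) mulr_sumr; apply: eq_bigr => q _.
by rewrite !mxE eqxx [q == j]eq_sym [k == i]eq_sym; ring.
Qed.

End inner_theory.

(** * Smoothness of vector-valued maps *)

Section row_valued.
Context {R : realType} {m n : nat}.
Implicit Types (U : set 'rV[R]_m).

Lemma row_valued_is_derive (E : 'I_n -> 'rV[R]_m -> R) u v (D : 'I_n -> R) :
  (forall k, is_derive u v (E k) (D k)) ->
  is_derive u v (fun w => \row_k E k w) (\row_k D k).
Proof.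
move=> dE.
have entry k : (fun w => (\row_j E j w) 0 k) = E k.
  by apply/funext => w; rewrite mxE.
have dM : derivable (fun w => \row_k E k w) u v.
  by apply/derivable_mxP => i j; rewrite ord1 entry; have [] := dE j.
apply: DeriveDef => //; rewrite derive_mx//; apply/rowP => k.
by rewrite !mxE entry; have [_ ->] := dE k.
Qed.

Lemma row_valued_continuous (E : 'I_n -> 'rV[R]_m -> R) u :
  (forall k, {for u, continuous (E k)}) ->
  {for u, continuous (fun w => \row_k E k w)}.
Proof.
move=> cE; apply/(@cvgrPdist_lt _ _ _ (nbhs u) _) => e e0.
have nearE : \forall w \near u, forall k, `|E k u - E k w| < e.
  apply: (filter_forall (F := nbhs u)) => k.
  exact: (cvgrPdist_lt _ _).1 (cE k) e e0.
apply: filterS nearE => w uw.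
rewrite /Num.Def.normr/= mx_normrE bigmax_lt// => -[i k] _ /=.
by rewrite !mxE.
Qed.

(** If [C] is closed under partial derivatives on [U], then by induction on the sequence every
    iterated partial derivative of [phi] agrees on [U] with a map whose components lie in [C]; no
    explicit formula for it is needed. *)
Lemma smooth_on_closed_class (C : set ('rV[R]_m -> R)) U (phi : 'rV[R]_m -> 'rV[R]_n) :
  open U ->
  (forall E, C E -> exists G : 'I_m -> 'rV[R]_m -> R,
    (forall i, C (G i)) /\ forall u, U u -> has_gradient E u (fun i => G i u)) ->
  (forall k, C (fun u => phi u 0 k)) -> smooth_on U phi.
Proof.
move=> openU CG Cphi.
have iterE (s : seq 'I_m) : exists E : 'I_n -> 'rV[R]_m -> R,
    (forall k, C (E k)) /\ forall u, U u -> iter_partial s phi u = \row_k E k u.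
  elim: s => [|i s [E [CE EE]]].
    by exists (fun k u => phi u 0 k); split => // u _; apply/rowP => k; rewrite mxE.
  have /choice[G GP] := fun k => CG _ (CE k).
  exists (fun k => G k i); split => [k|u Uu]; first exact: (GP k).1.
  have dE : is_derive u (delta_mx 0 i) (fun w => \row_k E k w) (\row_k G k i u).
    by apply: row_valued_is_derive => k; exact: has_gradient_partial ((GP k).2 u Uu).
  rewrite /= {1}/partial -[RHS](derive_val (is_derive := dE)).
  apply: near_eq_derive; near=> w; apply: EE; near: w.
  exact: open_nbhs_nbhs.
move=> s u Uu; have [E [CE EE]] := iterE s.
have /choice[G GP] := fun k => CG _ (CE k).
have nearE : \near u, \row_k E k u = iter_partial s phi u.
  by near=> w; rewrite EE//; near: w; exact: open_nbhs_nbhs.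
split.
  rewrite /prop_for /continuous_at EE//.
  apply: cvg_trans (near_eq_cvg nearE) _.
  apply: row_valued_continuous => k.
  exact: has_gradient_continuous ((GP k).2 u Uu).
move=> i; apply: near_eq_derivable nearE _.
have [] // := row_valued_is_derive (v := delta_mx 0 i)
  (fun k => has_gradient_partial i ((GP k).2 u Uu)).
Unshelve. all: by end_near. Qed.

End row_valued.

(** * Inserting and deleting one coordinate *)

Section insert_coordinate.
Context {R : realType} {m : nat}.
Variable l : 'I_m.+1.
Implicit Types (a b : R) (v w : 'rV[R]_m).

Definition insert_coord a v : 'rV[R]_m.+1 := \row_k oapp (v 0) a (unlift l k).

Lemma insert_coord_at a v : insert_coord a v 0 l = a.
Proof. by rewrite mxE unlift_none. Qed.

Lemma insert_coord_lift a v k : insert_coord a v 0 (lift l k) = v 0 k.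
Proof. by rewrite mxE liftK. Qed.

Lemma insert_coordP (x y : 'rV[R]_m.+1) :
  x 0 l = y 0 l -> (forall k, x 0 (lift l k) = y 0 (lift l k)) -> x = y.
Proof. by move=> xyl xyk; apply/rowP => k; case: (unliftP l k) => [j|] ->. Qed.

Lemma col'_insert_coord a v : col' l (insert_coord a v) = v.
Proof. by apply/rowP => k; rewrite mxE insert_coord_lift. Qed.

Lemma insert_coord_col' (x : 'rV[R]_m.+1) : insert_coord (x 0 l) (col' l x) = x.
Proof.
apply: insert_coordP => [|k]; first by rewrite insert_coord_at.
by rewrite insert_coord_lift mxE.
Qed.

Lemma dotv_insert_coord a b v w :
  dotv (insert_coord a v) (insert_coord b w) = a * b + dotv v w.
Proof.
rewrite /dotv (bigD1_ord l)//= !insert_coord_at; congr (_ + _).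
by apply: eq_bigr => k _; rewrite !insert_coord_lift.
Qed.

Lemma continuous_col' : continuous (fun x : 'rV[R]_m.+1 => col' l x).
Proof.
have -> : (fun x : 'rV[R]_m.+1 => col' l x) =
    fun x : 'rV[R]_m.+1 => \row_k x 0 (lift l k).
  by apply/funext => x; apply/rowP => k; rewrite !mxE.
by move=> x; apply: row_valued_continuous => k; exact: coord_continuous.
Qed.

End insert_coordinate.

(** * Separable graphs of constant curvature *)

Section separable_graph.
Context {R : realType} {m : nat}.
Variables (M : set 'rV[R]_m.+1) (l : 'I_m.+1).
Variables (U : set 'rV[R]_m) (J : set R) (h : 'rV[R]_m -> R).
Variables (F : 'I_m -> nat -> 'rV[R]_m -> R) (L : nat -> 'rV[R]_m -> R).

(* F k j u stands for the j-th derivative of f_k at u_k (k omitting the index l)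
   and L j u for the j-th derivative of f_l at h u, where x_l = h u solves
   f_l(x_l) + \sum_k f_k(u_k) = 0. *)
Let P u := (L 1 u)^-1.

Hypothesis openU : open U.
Hypothesis openJ : open J.
Hypothesis F_grad : forall u, U u -> forall k j,
  has_gradient (F k j) u (fun i => (k == i)%:R * F k j.+1 u).
Hypothesis L_grad : forall u, U u -> forall j,
  has_gradient (L j) u (fun i => - L j.+1 u * F i 1 u * P u).
Hypothesis L1_neq0 : forall u, U u -> L 1 u != 0.
Hypothesis h_grad : forall u, U u -> has_gradient h u (fun i => - F i 1 u * P u).
Hypothesis hJ : forall u, U u -> J (h u).
Hypothesis ME : forall x : 'rV[R]_m.+1, U (col' l x) -> J (x 0 l) ->
  (M x <-> x 0 l = h (col' l x)).

(** * The graph chart and the derivatives of [h] up to order three *)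

Let phi u := insert_coord l (h u) u.
(* h1, h2 and h3 are the partial derivatives of h of order 1, 2 and 3. *)
Let h1 i u := - F i 1 u * P u.
(** Chosen so that the [i]-th partial derivative of [P] is [F i 1 * T]; likewise that of [T] is
    [F i 1 * T']. *)
Let T u := L 2 u * P u ^+ 3.
Let h2 i j u := - ((i == j)%:R * F i 2 u * P u + F i 1 u * F j 1 u * T u).
Let T' u := 3 * P u ^+ 2 * T u * L 2 u - P u ^+ 4 * L 3 u.
Let h3 k i j u := - ((i == j)%:R * ((i == k)%:R * F i 3 u * P u + F i 2 u * F k 1 u * T u)
  + (i == k)%:R * F i 2 u * F j 1 u * T u + F i 1 u * (j == k)%:R * F j 2 u * T u
  + F i 1 u * F j 1 u * F k 1 u * T' u).

Lemma P_grad u : U u -> has_gradient P u (fun i => F i 1 u * T u).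
Proof.
move=> Uu.
apply: has_gradient_eq (has_gradientV (L1_neq0 Uu) (L_grad Uu 1)) _ => i /=.
by rewrite /T /P; field; exact: L1_neq0.
Qed.

Lemma T_grad u : U u -> has_gradient T u (fun i => F i 1 u * T' u).
Proof.
move=> Uu; have dP2 := has_gradientM (P_grad Uu) (P_grad Uu).
apply: has_gradient_eq
  (has_gradientM (L_grad Uu 2) (has_gradientM (P_grad Uu) dP2)) _ => i /=.
rewrite /T' /T; move: (L 2 u) (L 3 u) (F i 1 u) (P u) => a b c d; ring.
Qed.

Lemma delta_F2C u i j : (i == j)%:R * F i 2 u = (j == i)%:R * F j 2 u.
Proof. by rewrite eq_sym; case: eqP => [->//|_]; rewrite !mul0r. Qed.

Lemma h1_grad u i : U u -> has_gradient (h1 i) u (fun j => h2 j i u).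
Proof.
move=> Uu; have dF := has_gradientZ (-1) (F_grad Uu i 1).
have -> : h1 i = fun w => -1 * F i 1 w * P w.
  by apply/funext => w; rewrite mulN1r.
apply: has_gradient_eq (has_gradientM dF (P_grad Uu)) _ => j /=.
rewrite /h2 (delta_F2C u j i); move: (_%:R) (F i 1 u) (F j 1 u) (F i 2 u) (P u) (T u).
by move=> *; ring.
Qed.

Lemma h2_grad u i j : U u -> has_gradient (h2 i j) u (fun k => h3 k i j u).
Proof.
move=> Uu.
have dd := has_gradientZ (i == j)%:R (has_gradientM (F_grad Uu i 2) (P_grad Uu)).
have dFFT := has_gradientM (has_gradientM (F_grad Uu i 1) (F_grad Uu j 1)) (T_grad Uu).
have -> : h2 i j = fun w => -1 * ((i == j)%:R * (F i 2 w * P w) + F i 1 w * F j 1 w * T w).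
  by apply/funext => w; rewrite mulN1r mulrA.
apply: has_gradient_eq (has_gradientZ (-1) (has_gradientD dd dFFT)) _ => k /=.
rewrite /h3; move: (_ == _)%:R (_ == _)%:R (_ == _)%:R => a b c.
move: (F i 1 u) (F j 1 u) (F k 1 u) (F i 2 u) (F j 2 u) (F i 3 u) (P u) (T u) (T' u).
by move=> *; ring.
Qed.

Lemma h2_sym u i j : h2 i j u = h2 j i u.
Proof.
rewrite /h2 delta_F2C; move: (_%:R) (F i 1 u) (F j 1 u) (F j 2 u) (P u) (T u).
by move=> *; ring.
Qed.

(** The expression becomes symmetric only once the Kronecker deltas identify the indices of the [F]
    factors, hence the case split. *)
Lemma h3_sym u i j k : h3 i j k u = h3 j i k u.
Proof.
rewrite /h3 [k == i]eq_sym [k == j]eq_sym [j == i]eq_sym.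
have [->|ij] := eqVneq i j; first by [].
have [ejk|jk] := eqVneq j k; have [eik|ik] := eqVneq i k.
- by rewrite eik ejk eqxx in ij.
- by rewrite ejk /=; ring.
- by rewrite eik /=; ring.
- by rewrite /=; ring.
Qed.

(** A ring of functions containing the components of [phi] and closed under partial derivatives on
    [U], as [smooth_on_closed_class] requires. Inverses are not a closure operation, so [P] is a
    generator. *)
Inductive graph_class : set ('rV[R]_m -> R) :=
| graph_class_cst a : graph_class (fun=> a)
| graph_class_coord k : graph_class (fun u => u 0 k)
| graph_class_F k j : graph_class (F k j)
| graph_class_L j : graph_class (L j)
| graph_class_P : graph_class P
| graph_class_h : graph_class h
| graph_classD E E' : graph_class E -> graph_class E' ->
    graph_class (fun u => E u + E' u)
| graph_classM E E' : graph_class E -> graph_class E' ->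
    graph_class (fun u => E u * E' u).

Lemma graph_classN E : graph_class E -> graph_class (fun u => - E u).
Proof.
move=> gE; have -> : (fun u => - E u) = fun u => -1 * E u.
  by apply/funext => u; rewrite mulN1r.
by apply: graph_classM => //; exact: graph_class_cst.
Qed.

Lemma graph_class_grad E : graph_class E -> exists G : 'I_m -> 'rV[R]_m -> R,
  (forall i, graph_class (G i)) /\ forall u, U u -> has_gradient E u (fun i => G i u).
Proof.
elim => {E}.
- move=> a; exists (fun _ => fun=> 0); split => [i|u _]; first exact: graph_class_cst.
  exact: has_gradient_cst.
- move=> k; exists (fun i => fun=> (k == i)%:R).
  by split => [i|u _]; [exact: graph_class_cst|exact: has_gradient_coord].
- move=> k j; exists (fun i u => (k == i)%:R * F k j.+1 u).
  split => [i|u Uu]; last exact: F_grad.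
  by apply: graph_classM; [exact: graph_class_cst|exact: graph_class_F].
- move=> j; exists (fun i u => - L j.+1 u * F i 1 u * P u).
  split => [i|u Uu]; last exact: L_grad.
  apply: graph_classM graph_class_P; apply: graph_classM (graph_class_F _ _).
  exact/graph_classN/graph_class_L.
- exists (fun i u => F i 1 u * (L 2 u * (P u * (P u * P u)))); split => [i|u Uu].
    do 3!(apply: graph_classM; first by
      [exact: graph_class_F|exact: graph_class_L|exact: graph_class_P]).
    by apply: graph_classM; exact: graph_class_P.
  by apply: has_gradient_eq (P_grad Uu) _ => i; rewrite /T; ring.
- exists h1; split => [i|u Uu]; last exact: h_grad.
  by apply: graph_classM graph_class_P; exact/graph_classN/graph_class_F.
- move=> E E' gE [G [gG dG]] gE' [G' [gG' dG']].
  exists (fun i u => G i u + G' i u); split => [i|u Uu]; first exact: graph_classD.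
  by apply: has_gradientD; [exact: dG|exact: dG'].
- move=> E E' gE [G [gG dG]] gE' [G' [gG' dG']].
  exists (fun i u => G i u * E' u + E u * G' i u); split => [i|u Uu].
    by apply: graph_classD; exact: graph_classM.
  by apply: has_gradientM; [exact: dG|exact: dG'].
Qed.

Let phi_lift j : (fun u => phi u 0 (lift l j)) = fun u : 'rV[R]_m => u 0 j.
Proof. by apply/funext => u; rewrite insert_coord_lift. Qed.

Let phi_at : (fun u => phi u 0 l) = h.
Proof. by apply/funext => u; rewrite insert_coord_at. Qed.

Lemma smooth_graph : smooth_on U phi.
Proof.
apply: (smooth_on_closed_class openU graph_class_grad) => k.
case: (unliftP l k) => [j|] ->.
  by rewrite phi_lift; exact: graph_class_coord.
by rewrite phi_at; exact: graph_class_h.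
Qed.

(** * First-order geometry of the graph *)

Lemma partial_graph u i : U u ->
  partial i phi u = insert_coord l (h1 i u) (delta_mx 0 i).
Proof.
move=> Uu; have -> : phi = fun w => \row_k phi w 0 k.
  by apply/funext => w; apply/rowP => k; rewrite mxE.
suff d k : is_derive u (delta_mx 0 i) (fun w => phi w 0 k)
    (insert_coord l (h1 i u) (delta_mx 0 i) 0 k).
  rewrite /partial (derive_val (is_derive := row_valued_is_derive d)).
  by apply/rowP => k; rewrite mxE.
case: (unliftP l k) => [j|] ->.
  rewrite insert_coord_lift phi_lift.
  by have := has_gradient_partial i (has_gradient_coord u j); rewrite mxE eqxx.
by rewrite insert_coord_at phi_at; exact: has_gradient_partial (h_grad Uu).
Qed.

Lemma induced_metric_graph u i j : U u ->
  @induced_metric R m.+1 phi u i j = (i == j)%:R + h1 i u * h1 j u.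
Proof.
move=> Uu; rewrite mxE !partial_graph// dotv_insert_coord addrC; congr (_ + _).
rewrite /dotv -(sum_delta (fun k => (k == j)%:R) i); apply: eq_bigr => k _.
by rewrite !mxE eqxx/= [i == k]eq_sym.
Qed.

Lemma chart_differential_graph u (X : 'rV[R]_m) : U u ->
  @chart_differential R m.+1 phi u X = insert_coord l (\sum_i X 0 i * h1 i u) X.
Proof.
move=> Uu; rewrite /chart_differential; apply: (insert_coordP (l := l)) => [|k].
  rewrite insert_coord_at summxE; apply: eq_bigr => i _.
  by rewrite mxE partial_graph// insert_coord_at.
rewrite insert_coord_lift summxE -(sum_delta (fun i => X 0 i) k).
apply: eq_bigr => i _; rewrite mxE partial_graph// insert_coord_lift mxE eqxx/=.
by rewrite mulrC.
Qed.

(** This left inverse of the differential shows that [phi] is an immersion and that independent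
    vectors have independent images. *)
Lemma col'_chart_differential u (X : 'rV[R]_m) : U u ->
  col' l (@chart_differential R m.+1 phi u X) = X.
Proof. by move=> Uu; rewrite chart_differential_graph// col'_insert_coord. Qed.

Lemma local_parametrization_graph : local_parametrization M U phi.
Proof.
split; [exact: openU|exact: smooth_graph| | |].
- move=> u Uu X X0; rewrite -(col'_chart_differential X Uu) X0.
  by apply/rowP => k; rewrite !mxE.
- by move=> u v _ _ uv; rewrite -(col'_insert_coord l (h u) u) -/(phi u) uv col'_insert_coord.
move=> U' openU' U'U.
(* In the box over [U'] with [l]-th coordinate in [J], [M] is exactly the graph of [h], by [ME]. *)
exists (col' l @^-1` U' `&` (fun x : 'rV[R]_m.+1 => x 0 l) @^-1` J); split.
  apply: openI; apply: open_comp => // x _; first exact: continuous_col'.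
  exact: coord_continuous.
apply/seteqP; split => [_ [u U'u <-]|x [Mx [/= U'x Jx]]].
  have Uu := U'U _ U'u.
  have cu : col' l (phi u) = u by rewrite col'_insert_coord.
  have pl : phi u 0 l = h u by rewrite insert_coord_at.
  split; last by split; rewrite /= ?cu ?pl//; exact: hJ.
  by apply/ME; rewrite ?cu ?pl//; exact: hJ.
exists (col' l x) => //.
by rewrite /phi -(ME (U'U _ U'x) Jx).1// insert_coord_col'.
Qed.

(** * The Gauss equation under constant curvature *)

Variable c : R.
Hypothesis c_neq0 : c != 0.
Hypothesis hK : @constant_sectional_curvature R m.+1 M c.

Lemma graph_mem u : U u -> M (phi u).
Proof.
move=> Uu; apply/ME; rewrite ?col'_insert_coord ?insert_coord_at//; exact: hJ.
Qed.

(** The images of [X] and [Y] are independent and span a plane of vectors tangent through [phi]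
    itself, so [hK] applies to that plane with [phi] as parametrization. *)
Lemma sec_graph_eq u (X Y : 'rV[R]_m) : U u -> Y != 0 -> (forall k, X != k *: Y) ->
  sec (@induced_metric R m.+1 phi) u X Y = c.
Proof.
move=> Uu Y0 XY; pose d (Z : 'rV[R]_m) := @chart_differential R m.+1 phi u Z.
have dK Z : col' l (d Z) = Z := col'_chart_differential Z Uu.
have dlin a (Z Z' : 'rV[R]_m) : d (a *: Z + Z') = a *: d Z + d Z'.
  rewrite /d /chart_differential scaler_sumr -big_split/=; apply: eq_bigr => i _.
  by rewrite !mxE scalerDl scalerA.
have d0 : d 0 = 0.
  by rewrite /d /chart_differential big1// => i _; rewrite mxE scale0r.
have dZ a Z : d (a *: Z) = a *: d Z by rewrite -[a *: Z]addr0 dlin d0 addr0.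
have dY0 : d Y != 0.
  by apply: contra_neq Y0 => dY; rewrite -(dK Y) dY -d0 dK.
have freeXY : free [:: d X; d Y].
  rewrite free_cons seq1_free dY0 andbT span_seq1; apply/vlineP => -[k dXY].
  by have /eqP[] := XY k; rewrite -(dK X) dXY -dZ dK.
have secK : @sectional_curvature_eq R m.+1 M (phi u) <<[:: d X; d Y]>>%VS c.
  apply: hK; first exact: graph_mem.
    by move: freeXY; rewrite /free => /eqP.
  move=> v; rewrite span_cons span_seq1.
  move=> /memv_addP[_ /vlineP[a ->] [_ /vlineP[b ->] ->]].
  exists U, phi, u, (a *: X + b *: Y).
  split; [exact: local_parametrization_graph|exact: Uu|by []|].
  by rewrite -/(d _) dlin dZ.
exact: (secK U phi u X Y local_parametrization_graph Uu).
Qed.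

Let W u := 1 + \sum_q h1 q u ^+ 2.
Let g := @induced_metric R m.+1 phi.

Lemma gauss_equation u (X Y : 'rV[R]_m) : U u -> Y != 0 -> (forall k, X != k *: Y) ->
  second_form h2 u X X * second_form h2 u Y Y - second_form h2 u X Y ^+ 2 =
  c * W u * (inner g u X X * inner g u Y Y - inner g u X Y ^+ 2).
Proof.
move=> Uu Y0 XY.
apply: (graph_gauss_equation openU (fun u Uu i j => induced_metric_graph i j Uu)
  (fun u Uu i => h1_grad i Uu) (fun u Uu i j => h2_grad i j Uu)
  (fun u _ => h2_sym u) (fun u _ => h3_sym u) Uu c_neq0).
exact: sec_graph_eq.
Qed.

(** Mixed components are recovered from sectional curvatures of the planes spanned by [e_i] and one
    of [e_j], [e_k], [e_j + e_k]; the case [j = k] is the diagonal equation. *)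
Lemma gauss_equation_entry u i j k : U u -> i != j -> i != k ->
  h2 i i u * h2 j k u - h2 i j u * h2 i k u =
  c * W u * (g u i i * g u j k - g u i j * g u i k).
Proof.
move=> Uu ij ik.
have b_delta p q : second_form h2 u (delta_mx 0 p) (delta_mx 0 q) = h2 p q u.
  by rewrite /second_form inner_delta mxE.
have bDl X Y Z : second_form h2 u (X + Y) Z = second_form h2 u X Z + second_form h2 u Y Z.
  exact: innerDl.
have bDr X Y Z : second_form h2 u X (Y + Z) = second_form h2 u X Y + second_form h2 u X Z.
  exact: innerDr.
have g_sym p q : g u p q = g u q p.
  by rewrite !induced_metric_graph// eq_sym mulrC.
have diag q : i != q -> h2 i i u * h2 q q u - h2 i q u ^+ 2 =
    c * W u * (g u i i * g u q q - g u i q ^+ 2).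
  move=> iq; rewrite -!b_delta -!inner_delta; apply: gauss_equation => //.
    by apply/eqP => /rowP/(_ q)/eqP; rewrite !mxE !eqxx oner_eq0.
  move=> a; apply/eqP => /rowP/(_ i)/eqP.
  by rewrite !mxE !eqxx (negPf iq) mulr0 oner_eq0.
have [->|jk] := eqVneq j k; first by have := diag k ik; rewrite !expr2.
have Dj := diag j ij; have Dk := diag k ik.
(* Polarization of the two diagonal equations. *)
have : second_form h2 u (delta_mx 0 i) (delta_mx 0 i) *
    second_form h2 u (delta_mx 0 j + delta_mx 0 k) (delta_mx 0 j + delta_mx 0 k)
    - second_form h2 u (delta_mx 0 i) (delta_mx 0 j + delta_mx 0 k) ^+ 2 =
  c * W u * (inner g u (delta_mx 0 i) (delta_mx 0 i) *
    inner g u (delta_mx 0 j + delta_mx 0 k) (delta_mx 0 j + delta_mx 0 k)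
    - inner g u (delta_mx 0 i) (delta_mx 0 j + delta_mx 0 k) ^+ 2).
  apply: gauss_equation => //.
    apply/eqP => /rowP/(_ j)/eqP.
    by rewrite !mxE !eqxx (negPf jk) addr0 oner_eq0.
  move=> a; apply/eqP => /rowP/(_ i)/eqP.
  by rewrite !mxE !eqxx (negPf ij) (negPf ik) addr0 mulr0 oner_eq0.
rewrite !(bDl, bDr, innerDl, innerDr, b_delta, inner_delta).
rewrite (h2_sym u k j) (g_sym k j).
move: Dj Dk; move: (W u) (g u i i) (g u j k) (g u i j) (g u i k) (g u j j) (g u k k).
move: (h2 i i u) (h2 j k u) (h2 i j u) (h2 i k u) (h2 j j u) (h2 k k u).
move=> bii bjk bij bik bjj bkk w gii gjk gij gik gjj gkk Dj Dk Djk.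
apply: (mulfI (_ : 2 != 0)); first by rewrite pnatr_eq0.
transitivity ((bii * (bjj + bjk + (bjk + bkk)) - (bij + bik) ^+ 2)
  - (bii * bjj - bij ^+ 2) - (bii * bkk - bik ^+ 2)); first by ring.
by rewrite Djk Dj Dk; ring.
Qed.

(** The terms quadratic in [L 2] cancel on the left and those of degree four in the gradient on the
    right; then the factor [P u ^+ 2] is removed. *)
Lemma gauss_diagonal u i j : U u -> i != j ->
  F i 2 u * F j 2 u + L 2 u * P u ^+ 2 * (F i 2 u * F j 1 u ^+ 2 + F j 2 u * F i 1 u ^+ 2)
  = c * W u * (L 1 u ^+ 2 + F i 1 u ^+ 2 + F j 1 u ^+ 2).
Proof.
move=> Uu ij; have := gauss_equation_entry Uu ij ij.
rewrite /g !induced_metric_graph// /h2 /T /h1 !eqxx (negPf ij) /=.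
have L1 := L1_neq0 Uu; have LP : L 1 u = (P u)^-1 by rewrite invrK.
have P0 : P u != 0 by rewrite invr_eq0.
rewrite LP; move: (F i 1 u) (F j 1 u) (F i 2 u) (F j 2 u) (L 2 u) (W u) (P u) P0.
move=> a1 b1 a2 b2 l2 w p p0 E.
apply: (mulfI (expf_neq0 2 p0)).
transitivity (- (1 * a2 * p + a1 * a1 * (l2 * p ^+ 3)) *
    - (1 * b2 * p + b1 * b1 * (l2 * p ^+ 3)) -
    - (0 * a2 * p + a1 * b1 * (l2 * p ^+ 3)) *
    - (0 * a2 * p + a1 * b1 * (l2 * p ^+ 3))); first by ring.
by rewrite E; field.
Qed.

(** For distinct indices both sides of the Gauss equation reduce to multiples of
    [F j 1 u * F k 1 u * P u ^+ 2], which is cancelled. *)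
Lemma gauss_mixed u i j k : U u -> i != j -> i != k -> j != k ->
  F j 1 u != 0 -> F k 1 u != 0 -> F i 2 u * L 2 u * P u ^+ 2 = c * W u.
Proof.
move=> Uu ij ik jk Fj Fk; have := gauss_equation_entry Uu ij ik.
rewrite /g !induced_metric_graph// /h2 /T /h1 !eqxx (negPf ij) (negPf ik) (negPf jk) /=.
have P0 : P u != 0 by rewrite invr_eq0 L1_neq0.
move: (F i 1 u) (F j 1 u) (F k 1 u) (F i 2 u) (F j 2 u) (L 2 u) (W u) (P u) P0 Fj Fk.
move=> a1 b1 c1 a2 b2 l2 w p p0 b0 c0 E.
apply: (mulfI (mulf_neq0 (mulf_neq0 b0 c0) (expf_neq0 2 p0))).
transitivity (- (1 * a2 * p + a1 * a1 * (l2 * p ^+ 3)) *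
    - (0 * b2 * p + b1 * c1 * (l2 * p ^+ 3)) -
    - (0 * a2 * p + a1 * b1 * (l2 * p ^+ 3)) *
    - (0 * a2 * p + a1 * c1 * (l2 * p ^+ 3))); first by ring.
by rewrite E; ring.
Qed.

(** * Equality of all second derivatives *)

Hypothesis m_gt2 : (2 < m)%N.

(** The assumption [n > 3] enters here: it supplies the two further directions that [gauss_mixed]
    needs for every [i]. *)
Lemma other_indices (i : 'I_m) : exists j k : 'I_m, [/\ i != j, i != k & j != k].
Proof.
have : (1 < #|[set~ i]%SET|)%N by rewrite cardsC1 card_ord -ltnS prednK// ltnW// ltnW.
move=> /card_gt1P[j [k [/[!inE] ij ik jk]]]; exists j, k.
by rewrite ![i == _]eq_sym.
Qed.

(** By [gauss_mixed], [F i 2 u * L 2 u * P u ^+ 2] is the nonzero number [c * W u] for every [i], so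
    all [F i 2 u] have one nonzero value [a]. Replacing [c * W u] in [gauss_diagonal] leaves
    [a * a = a * L 2 u]. *)
Lemma umbilic_generic u : U u -> (forall k, F k 1 u != 0) ->
  forall i, F i 2 u = L 2 u.
Proof.
move=> Uu F0 i.
have [j [_ [ij _ _]]] := other_indices i.
have mixed q : F q 2 u * L 2 u * P u ^+ 2 = c * W u.
  have [j' [k' [qj qk jk]]] := other_indices q.
  exact: gauss_mixed jk _ _.
have W0 : c * W u != 0.
  by rewrite mulf_neq0// gt_eqF// (area_density_gt0 h1 u).
have := gauss_diagonal Uu ij; rewrite -(mixed i).
have Fij : F i 2 u = F j 2 u.
  have := mixed i; rewrite -(mixed j) -!mulrA; apply: mulIf.
  by apply: contra_neq W0 => L0; rewrite -(mixed i) -mulrA L0 mulr0.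
have LP : L 1 u = (P u)^-1 by rewrite invrK.
have P0 : P u != 0 by rewrite invr_eq0 L1_neq0.
have Fi0 : F i 2 u != 0.
  by apply: contra_neq W0 => Fi0; rewrite -(mixed i) Fi0 !mul0r.
rewrite -Fij LP; move: (F i 2 u) (L 2 u) (P u) (F i 1 u) (F j 1 u) P0 Fi0.
move=> a b p x y p0 a0 E; apply: (mulfI a0).
transitivity (a * a + b * p ^+ 2 * (a * y ^+ 2 + a * x ^+ 2)
   - b * p ^+ 2 * (a * y ^+ 2 + a * x ^+ 2)); first by ring.
by rewrite E; field.
Qed.

Hypothesis F_coord : forall k j (u v : 'rV[R]_m), u 0 k = v 0 k -> F k j u = F k j v.

(** If [F k 1] vanished on the ball, so would [F k 2 u], and [gauss_diagonal] would equate 0 with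
    [c * W u] times a positive number. *)
Let F1_not_locally0 u k (e : R) : 0 < e -> U u -> ball u e `<=` U ->
  exists2 w, ball u e w & F k 1 w != 0.
Proof.
move=> e0 Uu ueU; apply: contrapT => noW.
have F10 w : ball u e w -> F k 1 w = 0.
  by move=> uw; apply: contrapT => /eqP Fw; apply: noW; exists w.
have ueu : ball u e u by exact: ballxx.
have F20 : F k 2 u = 0.
  have <- : partial k (F k 1) u = F k 2 u.
    by rewrite (has_gradient_partialE k (F_grad Uu k 1)) eqxx mul1r.
  exact: (partial_near (ball_open u e) k ueu F10 (has_gradient_cst 0 u)).
have [j [_ [kj _ _]]] := other_indices k.
have := gauss_diagonal Uu kj; rewrite F20 F10//.
rewrite !(mul0r, expr0n, mulr0, addr0, mul0r)/= => /esym/eqP.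
rewrite !mulf_eq0 (negPf c_neq0)/= gt_eqF ?(area_density_gt0 h1 u)//=.
by rewrite gt_eqF// ltr_pwDl ?sqr_ge0// exprn_even_gt0// L1_neq0.
Qed.

(* umbilic_generic extends by continuity, as its points are dense by
   F1_not_locally0. *)
Lemma umbilic u i : U u -> F i 2 u = L 2 u.
Proof.
move=> Uu; pose E w := F i 2 w + -1 * L 2 w.
have cE : {for u, continuous E}.
  exact: has_gradient_continuous
    (has_gradientD (F_grad Uu i 2) (has_gradientZ (-1) (L_grad Uu 2))).
suff : E u = 0 by rewrite /E mulN1r => /eqP; rewrite subr_eq0 => /eqP.
apply: contrapT => /eqP Eu.
have nearE : \forall w \near u, E w != 0.
  by apply: (cE [set x | x != 0]); apply: open_nbhs_nbhs; split => //; exact: open_neq.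
have nearU : \forall w \near u, U w by exact: open_nbhs_nbhs.
have /nbhs_ballP[e /= e0 ueE] : nbhs u (U `&` [set w | E w != 0]) by exact: filterI.
have ueU : ball u e `<=` U by move=> w /ueE[].
have /choice[w wP] k : exists w, ball u e w /\ F k 1 w != 0.
  by have [w] := F1_not_locally0 k e0 Uu ueU; exists w.
(* The point [v] takes its [k]-th coordinate from [w k]. It stays in the ball because sup-norm balls
   are products, and [F_coord] makes every [F k 1 v] nonzero at once. *)
pose v : 'rV[R]_m := \row_k w k 0 k.
have uv : ball u e v.
  by split => // i0 k; rewrite ord1 mxE; exact: (wP k).1.2.
have [Uv /eqP] := ueE _ uv; apply.
rewrite /E (umbilic_generic Uv) ?mulN1r ?subrr// => k.
by rewrite (@F_coord k 1%N v (w k)) ?mxE//; exact: (wP k).2.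
Qed.

(** * Integration to a sphere *)

Variables (u0 : 'rV[R]_m) (delta : R).
Hypothesis delta_gt0 : 0 < delta.
Hypothesis UE : U = ball u0 delta.
Hypothesis L1_sign : forall u, U u -> 0 < L 1 u * L 1 u0.

Let A := L 2 u0.

Let Uu0 : U u0.
Proof. by rewrite UE; exact: ballxx. Qed.

Lemma L2_const u : U u -> L 2 u = A.
Proof.
move=> Uu; have [i [j [_ _ ij]]] := other_indices (Ordinal (ltnW (ltnW m_gt2))).
(* The point [v] shares coordinate [j] with [u] and coordinate [i] with [u0], so [umbilic] links
   [L 2 u] to [L 2 v] through [F j 2], and [L 2 v] to [L 2 u0] through [F i 2]. *)
pose v : 'rV[R]_m := \row_k if k == j then u 0 k else u0 0 k.
have Uv : U v.
  move: Uu; rewrite UE => -[_ uu0]; split => // i0 k; rewrite !ord1 mxE.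
  by case: ifP => _; [exact: uu0|exact: ballxx].
rewrite -(umbilic j Uu) (@F_coord j 2%N u v); last by rewrite mxE eqxx.
rewrite (umbilic j Uv) -(umbilic i Uv) (@F_coord i 2%N v u0) ?umbilic//.
by rewrite mxE; case: eqP => // ij'; move: ij; rewrite ij' eqxx.
Qed.

(** With all second derivatives zero at [u0], the left side of [gauss_diagonal] vanishes while its
    right side does not. *)
Lemma A_neq0 : A != 0.
Proof.
apply/eqP => A0; have [i [j [_ _ ij]]] := other_indices (Ordinal (ltnW (ltnW m_gt2))).
have := gauss_diagonal Uu0 ij; rewrite !umbilic// -/A A0.
rewrite !(mul0r, mulr0, addr0) => /esym/eqP.
rewrite !mulf_eq0 (negPf c_neq0)/= gt_eqF ?(area_density_gt0 h1 u0)//=.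
by rewrite gt_eqF// !ltr_pwDl ?sqr_ge0// exprn_even_gt0// L1_neq0.
Qed.

Let constU (E : 'rV[R]_m -> R) u :
  (forall w, U w -> has_gradient E w (fun=> 0)) -> U u -> E u = E u0.
Proof. by rewrite UE => dE uU; exact: zero_gradient_ball uU dE. Qed.

(** The coordinates of the centre: [F k 1] and [L 1] turn out to be affine with slope [A] in [u_k]
    and [h], with zeros [a k] and [al]. *)
Let a k := u0 0 k - F k 1 u0 / A.
Let al := h u0 - L 1 u0 / A.

Lemma F1_affine u k : U u -> F k 1 u = A * (u 0 k - a k).
Proof.
move=> Uu; have : F k 1 u + - A * u 0 k = F k 1 u0 + - A * u0 0 k.
  apply: (constU (E := fun w => F k 1 w + - A * w 0 k)) => // w Uw.
  apply: has_gradient_eq (has_gradientD (F_grad Uw k 1)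
    (has_gradientZ (- A) (has_gradient_coord w k))) _ => i /=.
  by rewrite umbilic// L2_const//; ring.
rewrite /a => /(canRL (addrK _)) ->.
by field; exact: A_neq0.
Qed.

Lemma L1_affine u : U u -> L 1 u = A * (h u - al).
Proof.
move=> Uu; have : L 1 u + - A * h u = L 1 u0 + - A * h u0.
  apply: (constU (E := fun w => L 1 w + - A * h w)) => // w Uw.
  apply: has_gradient_eq (has_gradientD (L_grad Uw 1)
    (has_gradientZ (- A) (h_grad Uw))) _ => i /=.
  by rewrite L2_const//; ring.
rewrite /al => /(canRL (addrK _)) ->.
by field; exact: A_neq0.
Qed.

Let Q (x : 'rV[R]_m.+1) := (x 0 l - al) ^+ 2 + \sum_k (x 0 (lift l k) - a k) ^+ 2.

Let Q_graph u : Q (phi u) = (h u - al) ^+ 2 + \sum_k (u 0 k - a k) ^+ 2.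
Proof.
rewrite /Q insert_coord_at; congr (_ + _).
by apply: eq_bigr => k _; rewrite insert_coord_lift.
Qed.

(** [Q] is the squared distance to the centre. By the affine formulas, the [i]-th partial derivative
    of [h] is [- (u_i - a i) / (h - al)], so the gradient of [Q] along the graph vanishes. *)
Lemma sphere_graph u : U u -> Q (phi u) = Q (phi u0).
Proof.
move=> Uu; apply: (constU (E := fun w => Q (phi w))) => // w Uw.
have -> : (fun w => Q (phi w)) =
    fun w => (h w + - al) * (h w + - al) + \sum_k (w 0 k + - a k) * (w 0 k + - a k).
  by apply/funext => v; rewrite Q_graph.
have dl := has_gradientD (h_grad Uw) (has_gradient_cst (- al) w).
have dk k := has_gradientD (has_gradient_coord w k) (has_gradient_cst (- a k) w).
apply: has_gradient_eq (has_gradientD (has_gradientM dl dl)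
  (has_gradient_sum (fun k => has_gradientM (dk k) (dk k)))) _ => i /=.
under eq_bigr => k _.
  rewrite eq_sym (_ : _ + _ = (i == k)%:R * (2 * (w 0 k - a k))); last by ring.
over.
rewrite sum_delta (F1_affine i Uw) /P (L1_affine Uw).
have := L1_neq0 Uw; rewrite (L1_affine Uw) mulf_eq0 negb_or => /andP[_ hw].
move: al a A_neq0 hw => al' a' A0 hw.
by field; rewrite A0 hw.
Qed.

Lemma separable_graph_hypersphere : exists (V : set 'rV[R]_m.+1) (b : 'rV[R]_m.+1) (r : R),
  [/\ 0 < r, V (phi u0), open_in M V & open_in (hypersphere b r) V].
Proof.
have signE u : U u -> 0 < (h u - al) * (h u0 - al).
  move=> Uu; have := L1_sign Uu; rewrite !L1_affine//.
  rewrite mulrACA pmulr_rgt0 -?expr2// exprn_even_gt0//=; exact: A_neq0.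
(* A line in direction [l] can meet the sphere in two points, opposite with respect to [al]; the
   sign condition keeps only the one on the graph. *)
pose O : set 'rV[R]_m.+1 := col' l @^-1` U `&` (fun x : 'rV[R]_m.+1 => x 0 l) @^-1`
  (J `&` [set t | 0 < (t - al) * (h u0 - al)]).
have openO : open O.
  apply: openI; apply: open_comp => //.
  - by move=> x _; exact: continuous_col'.
  - by move=> x _; exact: coord_continuous.
  apply: openI => //.
  have -> : [set t | 0 < (t - al) * (h u0 - al)] =
      (fun t : R => (t - al) * (h u0 - al)) @^-1` [set t | 0 < t] by [].
  apply: open_comp; last exact: open_gt.
  move=> t _; apply: cvgM; last exact: cvg_cst.
  by apply: cvgB; [exact: cvg_id|exact: cvg_cst].
have Ophi u : U u -> O (phi u).
  move=> Uu; rewrite /O /= col'_insert_coord insert_coord_at.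
  by split => //; split; [exact: hJ|exact: signE].
pose b := insert_coord l al (\row_k a k).
have Q0 : 0 < Q (phi u0).
  rewrite Q_graph ltr_pwDl//; last by apply: sumr_ge0 => k _; exact: sqr_ge0.
  by rewrite expr2 signE.
have hyperE x : hypersphere b (Num.sqrt (Q (phi u0))) x <-> Q x = Q (phi u0).
  have dE : dotv (x - b) (x - b) = Q x.
    have xb i : (x - b) 0 i = x 0 i - b 0 i by rewrite [LHS]mxE [X in _ + X]mxE.
    rewrite /dotv (bigD1_ord l)//= !xb insert_coord_at; congr (_ + _).
    by apply: eq_bigr => k _; rewrite xb insert_coord_lift mxE.
  rewrite /hypersphere/= /euclidean_norm dE; split => [/eqP|->//].
  rewrite eqr_sqrt ?(ltW Q0)//; first by move/eqP.
  by rewrite /Q addr_ge0 ?sqr_ge0// sumr_ge0// => k _; exact: sqr_ge0.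
exists (M `&` O), b, (Num.sqrt (Q (phi u0))); split.
- by rewrite sqrtr_gt0.
- by split; [exact: graph_mem|exact: Ophi].
- by exists O.
exists O; split => //; apply/seteqP; split => x [xM [Ux [Jx sx]]]; split => //.
  apply/hyperE; rewrite -(sphere_graph Ux) /phi -(ME Ux Jx).1//.
  by rewrite insert_coord_col'.
apply/(ME Ux Jx).
move/hyperE: xM; rewrite -(sphere_graph Ux) Q_graph /Q.
under [in RHS]eq_bigr do rewrite mxE.
move=> /addIr/eqP; rewrite eqf_sqr => /orP[/eqP/addIr//|/eqP xh].
have := signE _ Ux; move: sx => /= sx.
by rewrite -[h _ - al]opprK -xh mulNr oppr_gt0 => /lt_trans/(_ sx); rewrite ltxx.
Qed.

End separable_graph.

(** * Hypersurfaces *)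

(** Inverse function theorem in one variable, used to solve the defining equation for [x_l].
    Continuity keeps the sign of the derivative near [x0], and Rolle's theorem then gives
    injectivity on the ball. *)
Lemma local_inverse (R : realType) (f : R -> R) (I : set R) (x0 : R) :
  open I -> I x0 -> smooth1_on I f -> derive1 f x0 != 0 ->
  exists (g : R -> R) (e : R), [/\ 0 < e, ball x0 e `<=` I,
    forall x, ball x0 e x -> 0 < derive1 f x * derive1 f x0,
    forall x, ball x0 e x -> g (f x) = x /\ is_derive (f x) 1 g (derive1 f x)^-1 &
    \forall y \near f x0, ball x0 e (g y) /\ f (g y) = y].
Proof.
move=> openI Ix0 smoothf df0.
have cont_df : {for x0, continuous (derive1 f)}.
  exact/differentiable_continuous/derivable1_diffP/(smoothf 1%N).
have near_sign : \forall x \near x0, 0 < derive1 f x * derive1 f x0.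
  have cs : {for x0, continuous (fun x => derive1 f x * derive1 f x0)}.
    by apply: cvgM; [exact: cont_df|exact: cvg_cst].
  apply: (cs [set t | 0 < t]); apply: open_nbhs_nbhs; split; first exact: open_gt.
  by rewrite /= -expr2 exprn_even_gt0.
have near_I : \forall x \near x0, I x by exact: open_nbhs_nbhs.
have /nbhs_ballP[e /= e0 ballP] : nbhs x0 (I `&` [set x | 0 < derive1 f x * derive1 f x0]).
  exact: filterI.
have derf x : I x -> is_derive x 1 f (derive1 f x).
  by move=> Ix; apply: DeriveDef; [exact: (smoothf 0%N)|rewrite derive1E].
have ball_itv x y z : ball x0 e x -> ball x0 e y -> x <= z <= y -> ball x0 e z.
  rewrite -!ball_normE /ball_/= !ltr_distlC => /andP[x1 x2] /andP[y1 y2] /andP[xz zy].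
  by rewrite (lt_le_trans x1 xz) (le_lt_trans zy y2).
have injf x y : ball x0 e x -> ball x0 e y -> x < y -> f x <> f y.
  move=> Bx By xy fxy; have Bz z : x <= z <= y -> ball x0 e z := ball_itv x y z Bx By.
  have [||c] := Rolle xy _ _ fxy.
  - move=> z /[!in_itv]/= /andP[xz zy]; have [] // := derf z.
    by apply: (ballP z _).1; apply: Bz; rewrite !ltW.
  - apply: derivable_within_continuous => z /[!in_itv]/= xzy; have [] // := derf z.
    by apply: (ballP z _).1; exact: Bz.
  move=> /[!in_itv]/= /andP[xc cy] [_ Dc].
  have := (ballP c (Bz c _)).2; rewrite !ltW//= => /(_ isT).
  by rewrite derive1E Dc mul0r ltxx.
(* A chosen preimage in the ball; the default [x0] is taken only at values not attained there. *)
pose g y := xget x0 [set x | ball x0 e x /\ f x = y].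
have gK x : ball x0 e x -> g (f x) = x.
  move=> Bx; have [Bg fg] : [set z | ball x0 e z /\ f z = f x] (g (f x)).
    by apply: xgetPex; exists x.
  by apply/eqP; case: ltgtP => // /injf; [move/(_ Bg Bx)/(_ fg)|move/(_ Bx Bg)/(_ (esym fg))].
have nearB x : ball x0 e x -> \forall z \near x, ball x0 e z.
  by move=> Bx; apply: open_nbhs_nbhs; split => //; exact: ball_open.
have near_can x : ball x0 e x -> {near x, cancel f g}.
  by move=> Bx; apply: filterS (nearB x Bx) => z; exact: gK.
have near_cont x : ball x0 e x -> {near x, continuous f}.
  move=> Bx; apply: filterS (nearB x Bx) => z /ballP[Iz _].
  by apply/differentiable_continuous/derivable1_diffP; have [] := derf z Iz.
have Bx0 : ball x0 e x0 by exact: ballxx.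
exists g, e; split; first exact: e0.
- by move=> x /ballP[].
- by move=> x /ballP[].
- move=> x Bx; split; first exact: gK.
  apply: is_derive_inverse; [exact: near_can|exact: near_cont|exact: derf (ballP x Bx).1|].
  by apply/eqP => dfx; have := (ballP x Bx).2; rewrite /= dfx mul0r ltxx.
have [cg fgK] := near_can_continuousAcan_sym (near_can x0 Bx0) (near_cont x0 Bx0).
apply: filterI fgK; have := nbhs_singleton cg; rewrite /continuous_at gK// => cgx0.
by apply: cgx0; exact: nearB.
Qed.

Unset Implicit Arguments.

Theorem theorem4p6 (R : realType) (n : nat) (hn : (3 < n)%N)
  (M : set 'rV[R]_n) (c : R)
  (hM : separable_hypersurface M) (hc : c != 0)
  (hK : constant_sectional_curvature M c) :
  locally_open_part_of_hypersphere M.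
Proof.
(* Writing [n = m.+1] makes [n.-1] in the definitions reduce to [m]. *)
case: n hn M hM hK => // m; rewrite ltnS => m_gt2 M [f [I [openI smoothf ME0 regular]]] hK p Mp.
have Mp0 := Mp; rewrite ME0 in Mp0; case: Mp0 => Ip sump.
have [l dfl] : exists l, derive1 (f l) (p 0 l) != 0.
  apply: contrapT => no_l; have /eqP := regular p Mp; apply.
  apply: big1 => k _; have -> : derive1 (f k) (p 0 k) = 0; last by rewrite expr0n.
  by apply: contrapT => /eqP dfk; apply: no_l; exists k.
have [g [e [e0 BI sign gP near_g]]] :=
  local_inverse (openI l).1 (Ip l) (smoothf l) dfl.
pose S (u : 'rV[R]_m) := \sum_k f (lift l k) (u 0 k).
pose u0 : 'rV[R]_m := col' l p.
(* The solution [x_l] of [f l x_l + S u = 0]. *)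
pose h u := g (- S u).
pose F (k : 'I_m) j (u : 'rV[R]_m) := derive1n j (f (lift l k)) (u 0 k).
pose L j u := derive1n j (f l) (h u).
have sumE (x : 'rV[R]_m.+1) : \sum_k f k (x 0 k) = f l (x 0 l) + S (col' l x).
  rewrite (bigD1_ord l)//=; congr (_ + _).
  by apply: eq_bigr => k _; rewrite mxE.
have F_grad (u : 'rV[R]_m) : (forall k : 'I_m, I (lift l k) (u 0 k)) -> forall k j,
    has_gradient (F k j) u (fun i => (k == i)%:R * F k j.+1 u).
  move=> Iu k j.
  have dF : is_derive (u 0 k) 1 (derive1n j (f (lift l k))) (F k j.+1 u).
    by apply: DeriveDef; [exact: smoothf|rewrite -derive1E -derive1nS].
  apply: has_gradient_eq (has_gradient_comp (has_gradient_coord u k) dF) _ => i.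
  exact: mulrC.
have S_grad (u : 'rV[R]_m) : (forall k : 'I_m, I (lift l k) (u 0 k)) ->
    has_gradient (fun w => - S w) u (fun i => - F i 1 u).
  move=> Iu; have dS := has_gradient_sum (fun k => F_grad u Iu k 0%N).
  have -> : (fun w => - S w) = fun w => -1 * \sum_k F k 0%N w.
    by apply/funext => w; rewrite mulN1r.
  apply: has_gradient_eq (has_gradientZ (-1) dS) _ => i.
  by under eq_bigr do rewrite eq_sym; rewrite sum_delta mulN1r.
have Iu0 (k : 'I_m) : I (lift l k) (u0 0 k) by rewrite mxE; exact: Ip.
have Su0 : - S u0 = f l (p 0 l).
  by apply/esym/eqP; rewrite -subr_eq0 opprK -sumE sump.
have near_h : \forall u \near u0, ball (p 0 l) e (h u) /\ f l (h u) = - S u.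
  have := has_gradient_continuous (S_grad u0 Iu0).
  by rewrite /prop_for /continuous_at Su0 => cS; exact: (cS _ near_g).
have near_I : nbhs u0 [set u : 'rV[R]_m | forall k : 'I_m, I (lift l k) (u 0 k)].
  apply: (filter_forall (F := nbhs u0)) => k.
  have nI : nbhs (u0 0 k) (I (lift l k)).
    by apply: open_nbhs_nbhs; split; [exact: (openI _).1|exact: Iu0].
  exact: (@coord_continuous R 1 m 0 k u0 _ nI).
(* On a small ball around [u0], [h] takes values where [f l] is inverted and the other coordinates
   stay in their intervals; this ball serves as [U], and the ball of [local_inverse] as [J]. *)
have /nbhs_ballP[d /= d0 UP] : nbhs u0
    ([set u | ball (p 0 l) e (h u) /\ f l (h u) = - S u] `&`
     [set u : 'rV[R]_m | forall k : 'I_m, I (lift l k) (u 0 k)]).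
  exact: filterI.
have hB u : ball u0 d u -> ball (p 0 l) e (h u) by move=> /UP[[]].
have fh u : ball u0 d u -> f l (h u) = - S u by move=> /UP[[]].
have IU u : ball u0 d u -> forall k : 'I_m, I (lift l k) (u 0 k) by move=> /UP[].
have h_grad u : ball u0 d u -> has_gradient h u (fun i => - F i 1 u * (L 1 u)^-1).
  move=> Uu; have [_] := gP _ (hB u Uu); rewrite fh// => dg.
  apply: has_gradient_eq (has_gradient_comp (S_grad u (IU u Uu)) dg) _ => i.
  exact: mulrC.
have ME (x : 'rV[R]_m.+1) : ball u0 d (col' l x) -> ball (p 0 l) e (x 0 l) ->
    (M x <-> x 0 l = h (col' l x)).
  move=> Ux Jx; rewrite ME0; split.
    move=> [_]; rewrite sumE => /eqP; rewrite addr_eq0 => /eqP fx.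
    by rewrite /h -fx (gP _ Jx).1.
  move=> xh; split; last by rewrite sumE xh fh// addNr.
  move=> k; case: (unliftP l k) => [j|] ->; last exact: BI.
  by have := IU _ Ux j; rewrite mxE.
have hu0 : h u0 = p 0 l by rewrite /h Su0 (gP _ _).1//; exact: ballxx.
have L_grad u : ball u0 d u -> forall j,
    has_gradient (L j) u (fun i => - L j.+1 u * F i 1 u * (L 1 u)^-1).
  move=> Uu j; have dL : is_derive (h u) 1 (derive1n j (f l)) (L j.+1 u).
    apply: DeriveDef; last by rewrite -derive1E -derive1nS.
    by apply: smoothf; apply: BI; exact: hB.
  apply: has_gradient_eq (has_gradient_comp (h_grad u Uu) dL) _ => i.
  by rewrite !mulNr mulrN mulrA.
have L_sign u : ball u0 d u -> 0 < L 1 u * L 1 u0.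
  by move=> Uu; have := sign _ (hB u Uu); rewrite /L /= hu0.
have L_neq0 u : ball u0 d u -> L 1 u != 0.
  by move=> Uu; apply/eqP => Lu; have := L_sign u Uu; rewrite Lu mul0r ltxx.
have F_coord k j (u v : 'rV[R]_m) : u 0 k = v 0 k -> F k j u = F k j v.
  by rewrite /F => ->.
have [V [b [r [r0 Vp MV SV]]]] := separable_graph_hypersphere (ball_open u0 d)
  (ball_open _ _) (fun u Uu => F_grad u (IU u Uu)) L_grad L_neq0 h_grad hB ME
  hc hK m_gt2 F_coord d0 erefl L_sign.
exists V, b, r; split => //.
by move: Vp; rewrite /= hu0 insert_coord_col'.
Qed.
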